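(* Let $\mathcal{E}$ be a VH-space over the admissible space $Z$ and let $S_0(Z)\subseteq S_*(Z)$ be any family of seminorms generating the topology of $Z$. Then $\mathcal{L}_b^*(\mathcal{E},S_0(Z))$, with the topology given by the seminorms $\{\overline{p}\mid p\in S_0(Z)\}$, is a locally $C^*$-algebra. In particular $\mathcal{L}_b^*(\mathcal{E})$ is a locally $C^*$-algebra.
   Context: Ordered $*$-space: a complex vector space $Z$ with a conjugate linear involution $z\mapsto z^*$ and a convex cone $Z_+$ that is strict ($Z_+\cap -Z_+=\{0\}$) and consists of selfadjoint elements ($z^*=z$); for selfadjoint $z_1,z_2$, $z_1\ge z_2$ means $z_1-z_2\in Z_+$. Topologically ordered $*$-space: an ordered $*$-space $Z$ with a Hausdorff locally convex topology such that the involution is continuous, $Z_+$ is closed, and the topology is defined by a family of increasing seminorms, where a seminorm $p$ is increasing if $0\le x\le y$ implies $p(x)\le p(y)$. It is an admissible space if in addition it is complete. $S_*(Z)$ is the set of all continuous increasing seminorms $p$ on $Z$ with $p(z^* )=p(z)$ for all $z$; $S_*(Z)$ always generates the topology of $Z$. VE-space over $Z$: a complex vector space $\mathcal{E}$ with a map (gramian) $[\cdot,\cdot]\colon\mathcal{E}\times\mathcal{E}\to Z$ such that $[x,x]\ge 0$ with $[x,x]=0$ iff $x=0$, $[x,y]=[y,x]^*$, and $[\cdot,\cdot]$ is linear in the second variable. It carries the Hausdorff locally convex topology of the seminorms $\tilde p(x)=p([x,x])^{1/2}$, $p\in S_*(Z)$. A VH-space over an admissible space $Z$ is a VE-space over $Z$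 that is complete in this topology. A linear operator $T\colon\mathcal{E}\to\mathcal{E}$ is adjointable if there is a linear $T^*\colon\mathcal{E}\to\mathcal{E}$ with $[Te,f]=[e,T^*f]$ for all $e,f\in\mathcal{E}$. $\mathcal{L}_b^*(\mathcal{E},S_0(Z))$ is the set of adjointable linear operators $T$ on $\mathcal{E}$ such that for every $p\in S_0(Z)$ there is $C\ge0$ with $\tilde p(Tx)\le C\tilde p(x)$ for all $x\in\mathcal{E}$; $\overline p(T)$ is the infimum of all such $C$. The product is composition and the involution is $T\mapsto T^*$. $\mathcal{L}_b^*(\mathcal{E})=\mathcal{L}_b^*(\mathcal{E},S_*(Z))$. A locally $C^*$-algebra is a $*$-algebra with a complete Hausdorff topology induced by a family of $C^*$-seminorms, that is, seminorms $p$ with $p(a^*a)=p(a)^2$ for all $a$. *)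

(* Defs.v *)
From HB Require Import structures.
From mathcomp Require Import all_boot all_order all_algebra.
From mathcomp Require Import complex.
From mathcomp Require Import all_classical all_reals all_analysis.

Set Implicit Arguments.
Unset Strict Implicit.
Unset Printing Implicit Defensive.

Import Order.TTheory GRing.Theory Num.Theory.
Import numFieldNormedType.Exports.

Local Open Scope classical_set_scope.
Local Open Scope complex_scope.
Local Open Scope ring_scope.

(* The library's [tvsType] carries a uniform structure that is not required to
   be the one induced by addition, so its [cauchy] is not usable here.  All
   topological vector spaces below are [topologicalLmodType R[i]], local
   convexity is expressed by a defining family of seminorms, and completeness
   is taken for the uniformity of the additive group. *)

Definition is_seminorm (R : realType) (V : lmodType R[i]) (p : V -> R) : Prop :=
  (forall x y, p (x + y) <= p x + p y) /\
  (forall (a : R[i]) x, p (a *: x) = complex.Re `|a| * p x).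

(* The topology of V is the locally convex one defined by the seminorms in S:
   finite intersections of balls of S around x form a neighbourhood base. *)
Definition topology_defined_by (R : realType) (V : topologicalLmodType R[i])
    (S : set (V -> R)) : Prop :=
  (forall p, S p -> is_seminorm p) /\
  (forall (x : V) (U : set V), nbhs x U <->
    exists (F : set (V -> R)) (e : R), [/\ finite_set F, F `<=` S, 0 < e
      & [set y | forall p, F p -> p (y - x) < e] `<=` U]).

Definition complete_tvs (R : realType) (V : topologicalLmodType R[i]) : Prop :=
  forall F : set_system V, ProperFilter F ->
    (fun z : V * V => z.1 - z.2) @ (F, F) --> (0 : V) ->
    exists x : V, F --> x.

Definition conj_linear (R : realType) (V : lmodType R[i]) (star : V -> V) :=
  forall (a : R[i]) x y, star (a *: x + y) = a^* *: star x + star y.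

Record ordered_star_space (R : realType) (Z : lmodType R[i]) (star : Z -> Z)
    (Zpos : set Z) : Prop := {
  oss_star_conj_linear : conj_linear star;
  oss_starK : involutive star;
  oss_cone : forall (s t : R) x y, 0 <= s -> 0 <= t -> Zpos x -> Zpos y ->
    Zpos (s%:C *: x + t%:C *: y);
  oss_strict : Zpos `&` [set z | Zpos (- z)] = [set 0];
  oss_selfadjoint : forall z, Zpos z -> star z = z
}.

(* 0 <= x <= y means Zpos x and Zpos (y - x); x and y are then selfadjoint. *)
Definition increasing (R : realType) (Z : lmodType R[i]) (Zpos : set Z)
    (p : Z -> R) : Prop :=
  forall x y, Zpos x -> Zpos (y - x) -> p x <= p y.

Record topologically_ordered_star_space (R : realType)
    (Z : topologicalLmodType R[i]) (star : Z -> Z) (Zpos : set Z) : Prop := {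
  toss_ordered : ordered_star_space star Zpos;
  toss_hausdorff : hausdorff_space Z;
  toss_star_continuous : continuous star;
  toss_pos_closed : closed Zpos;
  toss_topology : exists S : set (Z -> R),
    topology_defined_by S /\ (forall p, S p -> increasing Zpos p)
}.

Record admissible_space (R : realType) (Z : topologicalLmodType R[i])
    (star : Z -> Z) (Zpos : set Z) : Prop := {
  adm_toss : topologically_ordered_star_space star Zpos;
  adm_complete : complete_tvs Z
}.

Definition Sstar (R : realType) (Z : topologicalLmodType R[i])
    (star : Z -> Z) (Zpos : set Z) : set (Z -> R) :=
  [set p | [/\ is_seminorm p, continuous p, increasing Zpos p
             & forall z, p (star z) = p z]].

Record ve_space (R : realType) (Z : lmodType R[i]) (star : Z -> Z)
    (Zpos : set Z) (E : lmodType R[i]) (gram : E -> E -> Z) : Prop := {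
  ve_ge0 : forall x, Zpos (gram x x);
  ve_eq0 : forall x, gram x x = 0 <-> x = 0;
  ve_sym : forall x y, gram x y = star (gram y x);
  ve_linear : forall x, linear (gram x)
}.

Definition tilde (R : realType) (Z E : lmodType R[i]) (gram : E -> E -> Z)
    (p : Z -> R) (x : E) : R := Num.sqrt (p (gram x x)).

Record vh_space (R : realType) (Z : topologicalLmodType R[i]) (star : Z -> Z)
    (Zpos : set Z) (E : topologicalLmodType R[i]) (gram : E -> E -> Z)
    : Prop := {
  vh_ve : ve_space star Zpos gram;
  vh_topology : topology_defined_by (tilde gram @` Sstar star Zpos);
  vh_complete : complete_tvs E
}.

Definition is_adjoint (R : realType) (Z E : lmodType R[i]) (gram : E -> E -> Z)
    (T T' : E -> E) : Prop :=
  linear T' /\ (forall e f, gram (T e) f = gram e (T' f)).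

Definition op_bounds (R : realType) (Z E : lmodType R[i]) (gram : E -> E -> Z)
    (p : Z -> R) (T : E -> E) : set R :=
  [set C | 0 <= C /\ forall x, tilde gram p (T x) <= C * tilde gram p x].

Definition Lbstar (R : realType) (Z E : lmodType R[i]) (gram : E -> E -> Z)
    (S0 : set (Z -> R)) : set (E -> E) :=
  [set T | [/\ linear T, exists T', is_adjoint gram T T'
             & forall p, S0 p -> op_bounds gram p T !=set0]].

Definition pbar (R : realType) (Z E : lmodType R[i]) (gram : E -> E -> Z)
    (p : Z -> R) (T : E -> E) : R := inf (op_bounds gram p T).

Record star_algebra (R : realType) (A : lmodType R[i]) (mul : A -> A -> A)
    (star : A -> A) : Prop := {
  sa_mulA : associative mul;
  sa_linear_r : forall a, linear (mul a);
  sa_linear_l : forall b, linear (mul ^~ b);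
  sa_star_conj_linear : conj_linear star;
  sa_starK : involutive star;
  sa_starM : forall a b, star (mul a b) = mul (star b) (star a)
}.

Record locally_cstar_algebra (R : realType) (A : topologicalLmodType R[i])
    (mul : A -> A -> A) (star : A -> A) : Prop := {
  lca_star_algebra : star_algebra mul star;
  lca_hausdorff : hausdorff_space A;
  lca_complete : complete_tvs A;
  lca_topology : exists S : set (A -> R), topology_defined_by S /\
    (forall p, S p -> forall a, p (mul (star a) a) = p a ^+ 2)
}.

(* A, with product mul and involution star, is L_b^*(E, S0): iota identifies
   the points of A with the operators in this set, the operations of A are the
   pointwise linear ones, composition and the adjoint, and the topology of A is
   the one given by the seminorms pbar, p in S0. *)
Record is_Lbstar_algebra (R : realType) (Z E : lmodType R[i])
    (gram : E -> E -> Z) (S0 : set (Z -> R)) (A : topologicalLmodType R[i])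
    (mul : A -> A -> A) (star : A -> A) (iota : A -> E -> E) : Prop := {
  Lb_inj : injective iota;
  Lb_range : range iota = Lbstar gram S0;
  Lb_linear : forall (c : R[i]) a b x,
    iota (c *: a + b) x = c *: iota a x + iota b x;
  Lb_mul : forall a b x, iota (mul a b) x = iota a (iota b x);
  Lb_star : forall a, is_adjoint gram (iota a) (iota (star a));
  Lb_topology : topology_defined_by
    [set (fun a : A => pbar gram p (iota a)) | p in S0]
}.

Definition Lbstar_is_locally_cstar (R : realType) (Z E : lmodType R[i])
    (gram : E -> E -> Z) (S0 : set (Z -> R)) : Prop :=
  exists (A : topologicalLmodType R[i]) (mul : A -> A -> A) (star : A -> A)
    (iota : A -> E -> E),
    is_Lbstar_algebra gram S0 mul star iota /\ locally_cstar_algebra mul star.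

(* Main.v *)
Require Import Defs.
From HB Require Import structures.
From mathcomp Require Import all_boot all_order all_algebra.
From mathcomp Require Import complex.
From mathcomp Require Import all_classical all_reals all_analysis.
From mathcomp Require Import ring lra.
Import Order.TTheory GRing.Theory Num.Theory.
Import numFieldNormedType.Exports.
Local Open Scope classical_set_scope.
Local Open Scope complex_scope.
Local Open Scope ring_scope.

Set Implicit Arguments.
Unset Strict Implicit.
Unset Printing Implicit Defensive.

(* If [x,y] >= 0, then 0 <= [tx - y, tx - y] gives
   2t [x,y] <= t^2 [x,x] + [y,y] for all t > 0, so every increasing seminorm p
   satisfies p([x,y]) <= p~(x) p~(y) with constant 1, although the Schwarz
   inequality for arbitrary x, y only holds with constant 4.  Applied to
   [T*y, T*y] = [T T*y, y] it shows that T* is bounded with pbar(T* ) <= pbar(T);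
   applied to [Tx, Tx] = [x, T*T x] it shows pbar(T)^2 <= pbar(T*T).  Together
   these give the C*-identity.  For completeness, a Cauchy filter of operators
   converges pointwise, uniformly relative to each p~, and so do the adjoints;
   linearity, boundedness and adjointness pass to the limit. *)

(** * Elementary rules for seminorms *)

Section Seminorm.
Variables (R : realType) (V : lmodType R[i]) (p : V -> R).
Hypothesis hp : is_seminorm p.

Lemma seminormD x y : p (x + y) <= p x + p y.
Proof. by case: hp. Qed.

Lemma seminormZ (a : R[i]) x : p (a *: x) = complex.Re `|a| * p x.
Proof. by case: hp. Qed.

Lemma seminorm0 : p 0 = 0.
Proof. by rewrite -(scale0r 0) seminormZ normr0 /= mul0r. Qed.

Lemma seminormN x : p (- x) = p x.
Proof. by rewrite -scaleN1r seminormZ normrN1 /= mul1r. Qed.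

Lemma seminorm_sub x y : p (x - y) = p (y - x).
Proof. by rewrite -seminormN opprB. Qed.

Lemma seminorm_ge0 x : 0 <= p x.
Proof.
have := seminormD x (- x); rewrite subrr seminorm0 seminormN.
by rewrite -mulr2n pmulrn_lge0.
Qed.

Lemma seminormZr (t : R) x : 0 <= t -> p (t%:C *: x) = t * p x.
Proof. by move=> t0; rewrite seminormZ ger0_norm ?lecR. Qed.

Lemma seminormB x y : p (x - y) <= p x + p y.
Proof. by rewrite -(seminormN y) seminormD. Qed.

Lemma seminorm_subD z x y : p (x - y) <= p (x - z) + p (z - y).
Proof. by rewrite -[x - y](subrKA z) seminormD. Qed.

End Seminorm.

(** * Neighbourhoods, convergence and separation in terms of seminorms *)

Section TopologyDefinedBy.
Variables (R : realType) (V : topologicalLmodType R[i]) (S : set (V -> R)).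
Hypothesis hS : topology_defined_by S.

Lemma filter_finite_ball (F : set_system V) {FF : Filter F}
    (D : set (V -> R)) (x : V) (e : R) : finite_set D ->
    (forall p, D p -> F [set y | p (y - x) < e]) ->
  F [set y | forall p, D p -> p (y - x) < e].
Proof.
move=> finD FD; pose f (p : V -> R) := [set y | p (y - x) < e].
have /= := @filter_bigI V (V -> R) (fset_set D) f F FF.
rewrite fset_setK// => h; apply: (filterS _ (h _)).
  by move=> y hy p /hy.
by move=> p; rewrite in_fset_set// inE; exact: FD.
Qed.

Lemma nbhs_seminorm p (x : V) (e : R) : S p -> 0 < e ->
  nbhs x [set y | p (y - x) < e].
Proof.
move=> Sp e0; apply/hS.2; exists [set p], e; split=> //.
- by move=> _ ->.
- by move=> y /= /(_ p erefl).
Qed.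

Lemma cvg_seminormP (F : set_system V) {FF : Filter F} (x : V) :
  F --> x <->
  (forall p, S p -> forall e, 0 < e -> F [set y | p (y - x) < e]).
Proof.
split=> [Fx p Sp e e0|FS U /hS.2 [D [e [finD DS e0 DU]]]].
  exact/Fx/nbhs_seminorm.
by apply: (filterS DU); apply: filter_finite_ball => // p /DS Sp; exact: FS.
Qed.

Lemma cauchy_seminormP (F : set_system V) {FF : Filter F} :
  (fun z : V * V => z.1 - z.2) @ (F, F) --> (0 : V) <->
  (forall p, S p -> forall e, 0 < e ->
     exists2 A, F A & forall a b, A a -> A b -> p (a - b) < e).
Proof.
split=> [Fc p Sp e e0|FS].
  have [[A B] /= [FA FB] AB] := Fc _ (nbhs_seminorm 0 Sp e0).
  exists (A `&` B) => [|a b [Aa _] [_ Bb]]; first exact: filterI.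
  by have := AB (a, b) (conj Aa Bb); rewrite /= subr0.
apply/cvg_seminormP => p Sp e e0; have [A FA hA] := FS p Sp e e0.
by exists (A, A) => // -[a b] /= [Aa Ab]; rewrite subr0; exact: hA.
Qed.

(** A point at which all seminorms vanish lies in every neighbourhood of 0. Conversely, the balls of
    radius [e / 2] around inseparable points [x] and [y] meet, so [p (x - y) <= e] for every [e]. *)
Lemma hausdorff_seminormP :
  hausdorff_space V <-> (forall x, (forall p, S p -> p x = 0) -> x = 0).
Proof.
split=> [hV x x0|sepV x y xy].
  apply/esym/hV => A B A0 Bx; exists x; split; last exact: nbhs_singleton.
  have /hS.2 [D [e [_ DS e0 DA]]] := A0.
  by apply: DA => p /DS Sp; rewrite subr0 x0.
apply/eqP; rewrite -subr_eq0; apply/eqP/sepV => p Sp.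
have hp := hS.1 p Sp; apply/eqP; rewrite eq_le seminorm_ge0// andbT.
apply/ler_addgt0Pr => e e0; rewrite add0r.
have e2 : 0 < e / 2 by rewrite divr_gt0.
have [z [zx zy]] := xy _ _ (nbhs_seminorm x Sp e2) (nbhs_seminorm y Sp e2).
apply: (le_trans (seminorm_subD hp z _ _)).
by rewrite [e]splitr lerD// ?(seminorm_sub hp x) ltW.
Qed.

End TopologyDefinedBy.

(** The proof [hS] is a phantom parameter of this copy of [V], so that the topology generated by [S]
    can be attached to it by canonical instances. *)
Definition seminorm_space (R : realType) (V : lmodType R[i])
  (S : set (V -> R)) (hS : forall p, S p -> is_seminorm p) : Type := V.

Lemma ltc_normE (R : realType) (z : R[i]) (d : R) :
  (`|z| < d%:C) = (complex.Re `|z| < d).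
Proof. by rewrite normc_def ltcR. Qed.

Lemma Re_normc_ge0 (R : realType) (z : R[i]) : 0 <= complex.Re `|z|.
Proof. by rewrite normc_def sqrtr_ge0. Qed.

(** * The topological vector space generated by a family of seminorms *)

Section SeminormSpace.
Variables (R : realType) (V : lmodType R[i]) (S : set (V -> R)).
Hypothesis hS : forall p, S p -> is_seminorm p.

Local Notation W := (seminorm_space hS).

HB.instance Definition _ := GRing.Lmodule.copy W V.

Definition seminorm_nbhs (x : W) : set_system W :=
  [set U | exists (F : set (V -> R)) (e : R), [/\ finite_set F, F `<=` S, 0 < e
      & [set y : V | forall p, F p -> p (y - x) < e] `<=` U]].

HB.instance Definition _ := hasNbhs.Build W seminorm_nbhs.

Let nbhs_filter (x : W) : ProperFilter (nbhs x).
Proof.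
apply: Build_ProperFilter_ex.
  move=> U [F [e [_ FS e0 FU]]]; exists x; apply: FU => p /FS/hS hp.
  by rewrite subrr seminorm0.
split.
- by exists set0, 1; split=> //; exact: ltr01.
- move=> U U' [F [e [finF FS e0 FU]]] [F' [e' [finF' FS' e0' FU']]].
  exists (F `|` F'), (Num.min e e'); split=> //.
  + by rewrite finite_setU.
  + by move=> p [/FS|/FS'].
  + by rewrite lt_min e0.
  + move=> y hy; split; [apply: FU => p Fp|apply: FU' => p Fp].
      by have := hy p (or_introl Fp); rewrite lt_min => /andP[].
    by have := hy p (or_intror Fp); rewrite lt_min => /andP[].
- move=> U U' UU' [F [e [finF FS e0 FU]]]; exists F, e; split=> //.
  exact: subset_trans UU'.
Qed.

Let nbhs_singleton (x : W) (U : set W) : nbhs x U -> U x.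
Proof.
move=> [F [e [_ FS e0 FU]]]; apply: FU => p /FS/hS hp.
by rewrite subrr seminorm0.
Qed.

Let nbhs_nbhs (x : W) (U : set W) : nbhs x U -> nbhs x (nbhs^~ U).
Proof.
move=> [F [e [finF FS e0 FU]]].
exists F, (e / 2); split=> //; first by rewrite divr_gt0.
move=> y hy; exists F, (e / 2); split=> //; first by rewrite divr_gt0.
move=> z hz; apply: FU => p Fp; rewrite [e]splitr.
apply: (le_lt_trans (seminorm_subD (hS (FS p Fp)) y _ _)).
by rewrite ltrD ?hy ?hz.
Qed.

HB.instance Definition _ :=
  Nbhs_isNbhsTopological.Build W nbhs_filter nbhs_singleton nbhs_nbhs.

Let add_continuous : continuous (fun z : W * W => z.1 + z.2).
Proof.
move=> [x y] U [F [e [finF FS e0 FU]]] /=.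
have e2 : 0 < e / 2 by rewrite divr_gt0.
exists ([set z : W | forall p, F p -> p (z - x) < e / 2],
        [set z : W | forall p, F p -> p (z - y) < e / 2])
  => [|[a b] /= [ha hb]].
  by split; exists F, (e / 2); split.
apply: FU => p Fp /=; rewrite opprD addrACA [e]splitr.
apply: (le_lt_trans (seminormD (hS (FS p Fp)) _ _)).
by rewrite ltrD ?ha ?hb.
Qed.

HB.instance Definition _ :=
  PreTopologicalNmodule_isTopologicalNmodule.Build W add_continuous.

Let scale_continuous : continuous (fun z : R[i]^o * W => z.1 *: z.2).
Proof.
move=> [c x] U [F [e [finF FS e0 FU]]] /=.
(* A sum bounds all [p x] with [p] in [F] at once, also when [F] is empty. *)
pose M := \sum_(p <- finmap.enum_fset (fset_set F)) `|p x|.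
have M0 : 0 <= M by exact: sumr_ge0.
have pM p : F p -> p x <= M.
  move=> Fp; apply: (le_trans (ler_norm _)).
  by rewrite /M (big_rem p) ?lerDl ?sumr_ge0//= in_fset_set ?inE.
pose K := complex.Re `|c| + 1.
have c0 : 0 <= complex.Re `|c| by rewrite normc_def /= sqrtr_ge0.
have K0 : 0 < K by rewrite ltr_pwDr.
(* The bound 1 keeps the modulus of [a] below [K]. The other bound makes the contribution of
   [(a - c) *: x] at most [e / 2], with [M + 1] in place of [M] to avoid a zero denominator. *)
pose d := Num.min 1 (e / (2 * (M + 1))).
have M1 : 0 < M + 1 by rewrite ltr_pwDr.
have d0 : 0 < d by rewrite lt_min ltr01 divr_gt0// mulr_gt0.
exists ([set a : R[i]^o | complex.Re `|a - c| < d],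
        [set z : W | forall p, F p -> p (z - x) < e / (2 * K)])
  => [|[a z] /= [ha hz]].
  split; last first.
    by exists F, (e / (2 * K)); split=> //; rewrite divr_gt0// mulr_gt0.
  apply/nbhs_ballP; exists (d%:C) => /=; first by rewrite ltcR.
  by move=> a; rewrite -ball_normE /= distrC ltc_normE.
apply: FU => p Fp /=; have hp := hS (FS p Fp).
have -> : a *: z - c *: x = a *: (z - x) + (a - c) *: x.
  by rewrite scalerBr scalerBl addrA subrK.
rewrite [e]splitr; apply: (le_lt_trans (seminormD hp _ _)).
rewrite !seminormZ//; apply: ltr_leD.
  have aK : complex.Re `|a| <= K.
    have : `|a| <= `|c| + `|a - c| by rewrite -{1}[a](subrKC c) ler_normD.
    rewrite !normc_def -rmorphD lecR => /le_trans; apply.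
    rewrite /K normc_def lerD2l ltW//; have := ha : complex.Re `|a - c| < d.
    by rewrite normc_def => /lt_le_trans; apply; rewrite /d ge_min lexx.
  apply: (@le_lt_trans _ _ (K * p (z - x))).
    by rewrite ler_wpM2r// seminorm_ge0.
  have -> : e / 2 = K * (e / (2 * K)) by field; rewrite gt_eqF.
  by rewrite ltr_pM2l// hz.
apply: (@le_trans _ _ (e / (2 * (M + 1)) * (M + 1))).
  apply: ler_pM; rewrite ?(seminorm_ge0 hp)//.
  - exact: Re_normc_ge0.
  - by rewrite ltW//; apply: (lt_le_trans ha); rewrite /d ge_min lexx orbT.
  - by rewrite (le_trans (pM p Fp))// lerDl.
by rewrite le_eqVlt; apply/orP; left; apply/eqP; field; rewrite gt_eqF.
Qed.

HB.instance Definition _ :=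
  TopologicalNmodule_isTopologicalLmodule.Build R[i] W scale_continuous.

Lemma seminorm_space_topology :
  topology_defined_by (V := W) S.
Proof. by []. Qed.

End SeminormSpace.

(** * Comparison of families of seminorms *)

Section TopologyComparison.
Variables (R : realType) (V : topologicalLmodType R[i]) (S : set (V -> R)).
Hypothesis hS : topology_defined_by S.

Lemma nbhs0_translate (x : V) (U : set V) :
  nbhs 0 U -> nbhs x [set y | U (y - x)].
Proof.
move=> /hS.2 [F [d [finF FS d0 FU]]]; apply/hS.2; exists F, d; split=> // y hy.
by apply: FU => p Fp; rewrite subr0; exact: hy.
Qed.

Lemma continuous_seminormP (p : V -> R) : is_seminorm p ->
  continuous p <-> (forall e, 0 < e -> nbhs 0 [set z | p z < e]).
Proof.
move=> hp; split=> [cp e e0|h x].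
  have := cp 0; rewrite /continuous_at (seminorm0 hp) => /cvgrPdist_lt/(_ e e0).
  by apply: filterS => z; rewrite sub0r normrN; exact/le_lt_trans/ler_norm.
apply/cvgrPdist_lt => e e0; apply: filterS (nbhs0_translate x (h e e0)) => y /=.
apply: le_lt_trans; rewrite ler_norml; apply/andP; split.
  by rewrite lerNl opprB lerBlDr -{1}[y](subrK x) seminormD.
by rewrite lerBlDr (seminorm_sub hp) -{1}[x](subrK y) seminormD.
Qed.

(** Both topologies are translation invariant, so it is enough to compare balls around 0. *)
Lemma topology_defined_by_equiv (S' : set (V -> R)) :
  (forall q, S' q -> is_seminorm q) ->
  (forall q, S' q -> forall e, 0 < e -> nbhs 0 [set y | q y < e]) ->
  (forall p, S p -> forall e, 0 < e -> exists (F : set (V -> R)) (d : R),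
     [/\ finite_set F, F `<=` S', 0 < d &
        [set y | forall q, F q -> q y < d] `<=` [set y | p y < e]]) ->
  topology_defined_by S'.
Proof.
move=> hS' S'S SS'; split=> // x U; split=> [/hS.2|] [F [e [finF FS e0 FU]]].
  (* [seminorm_space hS'] supplies the neighbourhood filter of [S'], in which finitely many balls
     can be intersected. *)
  have [] : @nbhs _ (seminorm_space hS') (x : seminorm_space hS')
      [set y | forall p, F p -> p (y - x) < e].
    apply: filter_finite_ball => // p /FS Sp.
    have [G [d [finG GS d0 Gd]]] := SS' p Sp e e0.
    by exists G, d; split=> // y hy; apply: Gd.
  move=> G [d [finG GS d0 GF]]; exists G, d; split=> //.
  exact: subset_trans FU.
apply: (filterS FU); apply: filter_finite_ball => // p /FS Sp.
exact: nbhs0_translate (S'S p Sp e e0).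
Qed.

End TopologyComparison.

Section RawLinear.
Variables (K : pzRingType) (U V : lmodType K) (f : U -> V).
Hypothesis hf : linear f.

Lemma linear_funD x y : f (x + y) = f x + f y.
Proof. by have := hf 1 x y; rewrite !scale1r. Qed.

Lemma linear_fun0 : f 0 = 0.
Proof. by apply: (@addrI _ (f 0)); rewrite -linear_funD !addr0. Qed.

Lemma linear_funZ a x : f (a *: x) = a *: f x.
Proof. by have := hf a x 0; rewrite linear_fun0 !addr0. Qed.

Lemma linear_funN x : f (- x) = - f x.
Proof. by rewrite -scaleN1r linear_funZ scaleN1r. Qed.

End RawLinear.

(** Divided by [t], the right side is minimal at [t = b / a], with value [2 * (a * b)]. In the
    degenerate cases another [t] contradicts [A > 0]: for [a = 0] the choice made gives
    [b ^+ 2 + 1 <= b ^+ 2], for [b = 0] it gives [A <= A / 2]. *)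
Lemma le_of_scaled_le (R : realType) (A a b : R) : 0 <= a -> 0 <= b ->
  (forall t, 0 < t -> t * A <= t ^+ 2 * a ^+ 2 + b ^+ 2) -> A <= 2 * (a * b).
Proof.
move=> a0 b0 h; rewrite leNgt; apply/negP => hA.
have A0 : 0 < A by rewrite (le_lt_trans _ hA)// !mulr_ge0.
have [a_gt0|] := ltP 0 a; last first.
  move=> ale0; have aE : a = 0 by apply/eqP; rewrite eq_le ale0.
  have t0 : 0 < (b ^+ 2 + 1) / A by rewrite divr_gt0// ltr_pwDr// sqr_ge0.
  have := h _ t0; rewrite aE expr0n mulr0 add0r divfK ?gt_eqF//.
  by rewrite gerDl ler10.
have [b_gt0|] := ltP 0 b; last first.
  move=> ble0; have bE : b = 0 by apply/eqP; rewrite eq_le ble0.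
  have a2 : 0 < 2 * a ^+ 2 by rewrite mulr_gt0// exprn_gt0.
  have := h _ (divr_gt0 A0 a2); rewrite bE expr0n addr0.
  have -> : (A / (2 * a ^+ 2)) ^+ 2 * a ^+ 2 = A / (2 * a ^+ 2) * (A / 2).
    by field; rewrite gt_eqF.
  rewrite ler_pM2l ?divr_gt0//; lra.
have := h _ (divr_gt0 b_gt0 a_gt0).
have -> : (b / a) ^+ 2 * a ^+ 2 + b ^+ 2 = b / a * (2 * (a * b)).
  by field; rewrite gt_eqF.
by rewrite ler_pM2l ?divr_gt0// leNgt hA.
Qed.

Lemma le_of_sqr_le (R : realType) (u c : R) : 0 <= u -> 0 <= c ->
  u ^+ 2 <= c * u -> u <= c.
Proof.
move=> u0 c0; have [u_gt0|] := ltP 0 u; last by move=> /le_trans + _; apply.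
by rewrite expr2 ler_pM2r.
Qed.

(** * Gramians, Schwarz inequalities and operator seminorms *)

Section Gramian.
Variables (R : realType) (Z E : lmodType R[i]) (star : Z -> Z) (Zpos : set Z).
Variable gram : E -> E -> Z.
Hypotheses (hZ : ordered_star_space star Zpos) (hE : ve_space star Zpos gram).

Lemma starD x y : star (x + y) = star x + star y.
Proof.
by have := oss_star_conj_linear hZ 1 x y; rewrite scale1r rmorph1 scale1r.
Qed.

Lemma star0 : star 0 = 0.
Proof. by apply: (@addrI _ (star 0)); rewrite -starD !addr0. Qed.

Lemma starZ (a : R[i]) x : star (a *: x) = a^* *: star x.
Proof.
by have := oss_star_conj_linear hZ a x 0; rewrite star0 !addr0.
Qed.

Lemma ZposZ (s : R) x : 0 <= s -> Zpos x -> Zpos (s%:C *: x).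
Proof.
by move=> s0 hx; have := oss_cone hZ s0 (lexx 0) hx hx; rewrite scale0r addr0.
Qed.

Lemma gramDr x y z : gram x (y + z) = gram x y + gram x z.
Proof. exact: linear_funD (ve_linear hE x) _ _. Qed.

Lemma gramZr (a : R[i]) x y : gram x (a *: y) = a *: gram x y.
Proof. exact: linear_funZ (ve_linear hE x) _ _. Qed.

Lemma gramDl x y z : gram (x + y) z = gram x z + gram y z.
Proof. by rewrite (ve_sym hE) gramDr starD -!(ve_sym hE). Qed.

Lemma gramZl (a : R[i]) x y : gram (a *: x) y = a^* *: gram x y.
Proof. by rewrite (ve_sym hE) gramZr starZ -(ve_sym hE). Qed.

Lemma gramNl x y : gram (- x) y = - gram x y.
Proof. by rewrite -(scaleN1r x) gramZl rmorphN rmorph1 scaleN1r. Qed.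

Lemma gramNr x y : gram x (- y) = - gram x y.
Proof. by rewrite -(scaleN1r y) gramZr scaleN1r. Qed.

Lemma gram_inj x y : (forall e, gram e x = gram e y) -> x = y.
Proof.
move=> h; apply/eqP; rewrite -subr_eq0; apply/eqP/(ve_eq0 hE).
by rewrite gramDr gramNr h subrr.
Qed.

Lemma polarization x y : 4%:R *: gram x y =
  (gram (x + y) (x + y) - gram (x - y) (x - y))
  - 'i *: (gram (x + 'i *: y) (x + 'i *: y) - gram (x - 'i *: y) (x - 'i *: y)).
Proof.
rewrite !(gramDl, gramDr, gramNl, gramNr, gramZl, gramZr, opprK).
(* Each difference of squares leaves twice its cross terms. In the pair with ['i] the terms from
   [gram x y] and [gram y x] carry opposite signs, so after the factor [- 'i] the latter cancels
   against the first pair. *)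
have h (a b c d : Z) : a + b + (c + d) - (a - b + (- c + d)) = (b + c) *+ 2.
  have -> : a + b + (c + d) = (b + c) + (a + d) by rewrite (addrC a) addrACA.
  have -> : a - b + (- c + d) = (a + d) - (b + c).
    by rewrite opprD [RHS]addrACA (addrC d).
  by rewrite opprB addrACA subrr addr0 mulr2n.
rewrite !h -scalerMnr scalerDr !scalerA -expr2 sqrCi conjCi mulrN -expr2 sqrCi.
rewrite opprK scaleN1r scale1r -mulrnBl opprD opprK addrACA subrr addr0 -mulr2n
  -mulrnA; exact: scaler_nat.
Qed.

Section Seminorm.
Variable p : Z -> R.
Hypotheses (hp : is_seminorm p) (incp : increasing Zpos p).
Hypothesis htp : is_seminorm (tilde gram p).

Lemma sqr_tilde x : tilde gram p x ^+ 2 = p (gram x x).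
Proof. by rewrite sqr_sqrtr// seminorm_ge0. Qed.

Let tilde_ge0 x : 0 <= tilde gram p x. Proof. exact: seminorm_ge0. Qed.

Lemma seminorm_gram_pos x y : Zpos (gram x y) ->
  p (gram x y) <= tilde gram p x * tilde gram p y.
Proof.
move=> hxy; rewrite -(ler_pM2l (ltr0n R 2)).
apply: le_of_scaled_le => // t t0.
(* A positive gramian is selfadjoint, so the two cross terms in the square of [t%:C *: x - y]
   coincide. *)
have gyx : gram y x = gram x y by rewrite (ve_sym hE) (oss_selfadjoint hZ).
rewrite mulrA -seminormZr// ?mulr_ge0 ?(ltW t0)//.
rewrite !sqr_tilde -seminormZr ?sqr_ge0//.
apply: (le_trans _ (seminormD hp _ _)); apply: incp.
  by apply: ZposZ => //; rewrite mulr_ge0// ltW.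
have := ve_ge0 hE (t%:C *: x - y).
congr Zpos.
rewrite !(gramDl, gramDr, gramNl, gramNr, gramZl, gramZr, opprK) gyx.
have -> : (t%:C)^* = t%:C :> R[i] by exact: conjc_real.
rewrite scalerBr scalerA -rmorphM -expr2 opprB addrACA -opprD.
rewrite -scalerDl -rmorphD.
by have -> : t * 2 = t + t by ring.
Qed.

(** Polarization takes the place of positivity. It bounds [p (gram u v)] by twice a sum of squares,
    and the optimal scaling of [y] costs another factor 2, which makes 4. *)
Lemma seminorm_gram x y :
  p (gram x y) <= 4 * (tilde gram p x * tilde gram p y).
Proof.
have h u v : p (gram u v) <= 2 * (tilde gram p u ^+ 2 + tilde gram p v ^+ 2).
  (* All four polarization terms have a coefficient of modulus 1, so the triangle inequality for
     [tilde gram p] bounds them alike. *)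
  have q (c : R[i]) : complex.Re `|c| = 1 ->
      p (gram (u + c *: v) (u + c *: v)) <=
        (tilde gram p u + tilde gram p v) ^+ 2.
    move=> c1; rewrite -sqr_tilde lerXn2r ?nnegrE ?addr_ge0//.
    by apply: (le_trans (seminormD htp _ _)); rewrite seminormZ// c1 mul1r.
  have c1 : complex.Re `|1 : R[i]| = 1 by rewrite normr1.
  have cN1 : complex.Re `|- 1 : R[i]| = 1 by rewrite normrN normr1.
  have ci : complex.Re `|'i : R[i]| = 1 by rewrite normCi.
  have cNi : complex.Re `|- 'i : R[i]| = 1 by rewrite normrN normCi.
  have := q _ c1; have := q _ cN1; have := q _ ci; have := q _ cNi.
  rewrite scale1r scaleN1r scaleNr => qNi qi qN1 q1.
  have : 4 * p (gram u v) <= 4 * (tilde gram p u + tilde gram p v) ^+ 2.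
    have -> : 4 * p (gram u v) = p (4%:R *: gram u v).
      by rewrite seminormZ// normr_nat raddfMn.
    rewrite polarization; apply: (le_trans (seminormB hp _ _)).
    rewrite (seminormZ hp) ci mul1r.
    have := seminormB hp (gram (u + v) (u + v)) (gram (u - v) (u - v)).
    have := seminormB hp (gram (u + 'i *: v) (u + 'i *: v))
                         (gram (u - 'i *: v) (u - 'i *: v)).
    lra.
  have := sqr_ge0 (tilde gram p u - tilde gram p v).
  rewrite !expr2; nra.
have -> : 4 = 2 * 2 :> R by ring.
rewrite -mulrA -ler_pdivrMl// (mulrC (tilde gram p x)).
apply: le_of_scaled_le => // t t0.
rewrite mulrCA -(seminormZr hp _ (ltW t0)) -gramZr ler_pdivrMl//.
by apply: (le_trans (h _ _)); rewrite (seminormZr htp _ (ltW t0)) exprMn addrC.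
Qed.

Section Operators.
Variables T T' : E -> E.

(** Every bound dominates the quotient of [tilde gram p (T x)] by [tilde gram p x], hence so does
    the infimum. Where the denominator vanishes, any single bound already forces the numerator to be
    0. *)
Lemma pbar_le : op_bounds gram p T !=set0 ->
  forall x, tilde gram p (T x) <= pbar gram p T * tilde gram p x.
Proof.
move=> [C [C0 hC]] x; have [x0|] := ltP 0 (tilde gram p x); last first.
  move=> xle0; have x0 : tilde gram p x = 0 by apply/eqP; rewrite eq_le xle0 /=.
  by have := hC x; rewrite x0 !mulr0.
rewrite -ler_pdivrMr//; apply: lb_le_inf; first by exists C.
by move=> D [_ hD]; rewrite ler_pdivrMr.
Qed.

Lemma pbar_le_bound C : op_bounds gram p T C -> pbar gram p T <= C.
Proof. by apply: ge_inf; exists 0 => D []. Qed.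

Lemma pbar_ge0 : op_bounds gram p T !=set0 -> 0 <= pbar gram p T.
Proof. by move=> hT; apply: lb_le_inf => // D []. Qed.

Lemma op_bounds_pbar : op_bounds gram p T !=set0 ->
  op_bounds gram p T (pbar gram p T).
Proof. by move=> hT; split; [exact: pbar_ge0|exact: pbar_le]. Qed.

Lemma op_bounds_adjoint C : is_adjoint gram T T' ->
  op_bounds gram p T C -> op_bounds gram p T' C.
Proof.
move=> [_ adj] [C0 hC]; split=> // y.
(* With [u = tilde gram p (T' y)], the bound for positive gramians gives
   [u ^+ 2 <= C * tilde gram p y * u], and one factor [u] cancels. *)
apply: le_of_sqr_le => //; first by rewrite mulr_ge0.
rewrite sqr_tilde -adj.
have pos : Zpos (gram (T (T' y)) y) by rewrite adj; exact: (ve_ge0 hE).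
apply: (le_trans (seminorm_gram_pos pos)).
by rewrite mulrAC ler_wpM2r.
Qed.

End Operators.

Lemma op_bounds_comp T U C D : op_bounds gram p T C -> op_bounds gram p U D ->
  op_bounds gram p (T \o U) (C * D).
Proof.
move=> [C0 hC] [D0 hD]; split=> [|x]; first by rewrite mulr_ge0.
by apply: (le_trans (hC _)); rewrite -mulrA ler_wpM2l.
Qed.

Lemma op_boundsD T U C D : op_bounds gram p T C -> op_bounds gram p U D ->
  op_bounds gram p (T + U) (C + D).
Proof.
move=> [C0 hC] [D0 hD]; split=> [|x]; first by rewrite addr_ge0.
by apply: (le_trans (seminormD htp _ _)); rewrite mulrDl lerD.
Qed.

Lemma op_boundsZ c T C : op_bounds gram p T C ->
  op_bounds gram p (c *: T) (complex.Re `|c| * C).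
Proof.
move=> [C0 hC]; split=> [|x]; first by rewrite mulr_ge0// Re_normc_ge0.
by rewrite (seminormZ htp) -mulrA ler_wpM2l// Re_normc_ge0.
Qed.

Lemma pbarD T U : op_bounds gram p T !=set0 -> op_bounds gram p U !=set0 ->
  pbar gram p (T + U) <= pbar gram p T + pbar gram p U.
Proof.
by move=> hT hU; apply: pbar_le_bound; apply: op_boundsD; exact: op_bounds_pbar.
Qed.

Lemma pbarZ c T : op_bounds gram p T !=set0 ->
  pbar gram p (c *: T) = complex.Re `|c| * pbar gram p T.
Proof.
move=> hT; apply/eqP; rewrite eq_le; apply/andP; split.
  by apply: pbar_le_bound; apply: op_boundsZ; exact: op_bounds_pbar.
have hcT : op_bounds gram p (c *: T) !=set0.
  by have [C hC] := hT; exists (complex.Re `|c| * C); exact: op_boundsZ.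
have [c0|c0] := eqVneq (complex.Re `|c|) 0; first by rewrite c0 mul0r pbar_ge0.
have cpos : 0 < complex.Re `|c| by rewrite lt_def c0 Re_normc_ge0.
(* For nonzero [c], dividing the seminorm of [c *: T] by the modulus of [c] gives a bound for
   [T]. *)
rewrite -ler_pdivlMl//; apply: pbar_le_bound; split.
  by rewrite mulr_ge0 ?invr_ge0 ?pbar_ge0// ltW.
move=> x; rewrite -mulrA ler_pdivlMl// -(seminormZ htp).
exact: (pbar_le hcT).
Qed.

Lemma pbar_cstar T T' : is_adjoint gram T T' ->
  op_bounds gram p T !=set0 -> pbar gram p (T' \o T) = pbar gram p T ^+ 2.
Proof.
move=> adj hT; have T0 := pbar_ge0 hT.
have bT' : op_bounds gram p T' (pbar gram p T).
  by apply: (op_bounds_adjoint adj); exact: op_bounds_pbar.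
have bT'T := op_bounds_comp bT' (op_bounds_pbar hT).
have hT'T : op_bounds gram p (T' \o T) !=set0 by eexists; exact: bT'T.
apply/eqP; rewrite eq_le; apply/andP; split; first exact: pbar_le_bound bT'T.
have H0 := pbar_ge0 hT'T.
(* For the reverse inequality, the square root of [pbar gram p (T' \o T)] is shown to be a bound for
   [T]. *)
rewrite -[leRHS]sqr_sqrtr// lerXn2r ?nnegrE ?sqrtr_ge0//.
apply: pbar_le_bound; split=> [|x]; first exact: sqrtr_ge0.
rewrite -(@ler_pXn2r _ 2) ?nnegrE ?mulr_ge0 ?sqrtr_ge0//.
rewrite sqr_tilde adj.2 exprMn sqr_sqrtr//.
have pos : Zpos (gram x (T' (T x))) by rewrite -adj.2; exact: (ve_ge0 hE).
apply: (le_trans (seminorm_gram_pos pos)).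
rewrite expr2 mulrCA ler_wpM2l//.
exact: (pbar_le hT'T).
Qed.

End Seminorm.
End Gramian.

(** * Submodules as types *)

Section SubmoduleType.
Variables (K : pzRingType) (V : lmodType K) (P : V -> bool).
Hypothesis hP : submod_closed P.

(* The closure proof is a phantom argument, so that the instances below can be
   declared for it. *)
Definition submod_pred (_ : submod_closed P) : V -> bool := P.

Definition submod_type : Type := {x : V | submod_pred hP x}.

HB.instance Definition _ := GRing.isSubmodClosed.Build K V (submod_pred hP) hP.
HB.instance Definition _ := SubChoice.on submod_type.
HB.instance Definition _ :=
  [SubChoice_isSubLmodule of submod_type by <:].

End SubmoduleType.

(** This yields identities in the limit: the seminorm of a defect is at most [e] times a fixed
    [M]. *)
Lemma le0_of_le_eps (R : realType) (u M : R) :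
  (forall e, 0 < e -> u <= e * M) -> u <= 0.
Proof.
move=> h; have [M0|M0] := leP M 0.
  by apply: (le_trans (h 1 ltr01)); rewrite mul1r.
apply/ler_addgt0Pr => e e0; rewrite add0r.
by apply: (le_trans (h (e / M) _)); rewrite ?divr_gt0// divfK// gt_eqF.
Qed.

(** * Closure properties and module structure of the bounded adjointable operators *)

Section BoundedOperators.
Variables (R : realType) (Z E : lmodType R[i]) (star : Z -> Z) (Zpos : set Z).
Variables (gram : E -> E -> Z) (S0 : set (Z -> R)).
Hypotheses (hZ : ordered_star_space star Zpos) (hE : ve_space star Zpos gram).
Hypothesis hS0 : forall p, S0 p ->
  [/\ is_seminorm p, increasing Zpos p & is_seminorm (tilde gram p)].

Let hs p : S0 p -> is_seminorm p. Proof. by case/hS0. Qed.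
Let hi p : S0 p -> increasing Zpos p. Proof. by case/hS0. Qed.
Let ht p : S0 p -> is_seminorm (tilde gram p). Proof. by case/hS0. Qed.

Lemma adjoint_sym T T' : linear T -> is_adjoint gram T T' ->
  is_adjoint gram T' T.
Proof.
move=> linT [_ adj]; split=> // e f.
by rewrite (ve_sym hE) -adj -(ve_sym hE).
Qed.

Lemma adjoint_unique T T1 T2 :
  is_adjoint gram T T1 -> is_adjoint gram T T2 -> T1 = T2.
Proof.
move=> [_ adj1] [_ adj2]; apply: funext => x.
by apply: (gram_inj hE) => e; rewrite -adj1 -adj2.
Qed.

Lemma adjoint_comp T T' U U' : is_adjoint gram T T' -> is_adjoint gram U U' ->
  is_adjoint gram (T \o U) (U' \o T').
Proof.
move=> [linT' adjT] [linU' adjU]; split=> [c x y|e f] /=.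
  by rewrite linT' linU'.
by rewrite adjT adjU.
Qed.

Lemma adjoint_linear c T T' U U' :
  is_adjoint gram T T' -> is_adjoint gram U U' ->
  is_adjoint gram (c *: T + U) (c^* *: T' + U').
Proof.
move=> [linT' adjT] [linU' adjU]; split=> [a x y|e f].
  rewrite !fctE linT' linU' !scalerDr !scalerA (mulrC a) -!addrA; congr (_ + _).
  by rewrite !addrA; congr (_ + _); rewrite addrC.
rewrite !fctE (gramDl hZ hE) (gramZl hZ hE) (gramDr hE) (gramZr hE).
by rewrite adjT adjU.
Qed.

Lemma Lbstar_linear_closed c T U : Lbstar gram S0 T -> Lbstar gram S0 U ->
  Lbstar gram S0 (c *: T + U).
Proof.
move=> [linT [T' adjT] bT] [linU [U' adjU] bU]; split=> [a x y||p Sp].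
- rewrite !fctE linT linU !scalerDr !scalerA (mulrC a) -!addrA; congr (_ + _).
  by rewrite !addrA; congr (_ + _); rewrite addrC.
- by eexists; exact: adjoint_linear adjT adjU.
- have [C hC] := bT p Sp; have [D hD] := bU p Sp.
  by eexists; apply: op_boundsD (ht Sp) _ _ _ _ (op_boundsZ (ht Sp) c hC) hD.
Qed.

Lemma Lbstar0 : Lbstar gram S0 0.
Proof.
have z (x : E) : (0 : E -> E) x = 0 by [].
split=> [a x y||p Sp]; first by rewrite !z scaler0 addr0.
- exists 0; split=> [a x y|e f]; first by rewrite !z scaler0 addr0.
  by rewrite !z -(scale0r 0) (gramZl hZ hE) (gramZr hE) rmorph0 !scale0r.
- by exists 0; split=> // x; rewrite z (seminorm0 (ht Sp)) mul0r.
Qed.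

Lemma Lbstar_comp T U : Lbstar gram S0 T -> Lbstar gram S0 U ->
  Lbstar gram S0 (T \o U).
Proof.
move=> [linT [T' adjT] bT] [linU [U' adjU] bU]; split=> [a x y||p Sp].
- by rewrite /= linU linT.
- by eexists; exact: adjoint_comp adjT adjU.
- have [C hC] := bT p Sp; have [D hD] := bU p Sp.
  by eexists; exact: op_bounds_comp hC hD.
Qed.

Lemma Lbstar_adjoint T T' : Lbstar gram S0 T -> is_adjoint gram T T' ->
  Lbstar gram S0 T'.
Proof.
move=> [linT _ bT] adj; split=> [||p Sp]; first by case: adj.
- by exists T; exact: adjoint_sym.
- have [C hC] := bT p Sp; exists C.
  exact: (op_bounds_adjoint hZ hE (hs Sp) (hi Sp) (ht Sp) adj hC).
Qed.

Definition Lbstar_pred (T : E -> E) : bool := `[< Lbstar gram S0 T >].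

Lemma Lbstar_submod_closed : submod_closed Lbstar_pred.
Proof.
split=> [|a T U]; first exact/asboolP/Lbstar0.
by move=> /asboolP hT /asboolP hU; apply/asboolP/Lbstar_linear_closed.
Qed.

Definition Lbstar_op : Type := submod_type Lbstar_submod_closed.
HB.instance Definition _ := GRing.Lmodule.copy Lbstar_op
  (submod_type Lbstar_submod_closed).

Definition Lbstar_fun (a : Lbstar_op) : E -> E := val a.

Definition Lbstar_mk T (hT : Lbstar gram S0 T) : Lbstar_op :=
  exist _ T (introT (asboolP _) hT).

Lemma Lbstar_funP a : Lbstar gram S0 (Lbstar_fun a).
Proof. exact/asboolP/(valP a). Qed.

Lemma Lbstar_fun_inj : injective Lbstar_fun.
Proof. exact: val_inj. Qed.

End BoundedOperators.

(** * Pointwise limits of Cauchy filters of operators *)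

Section PointwiseLimit.
Variables (R : realType) (Z : lmodType R[i]) (E : topologicalLmodType R[i]).
Variables (gram : E -> E -> Z) (S0 : set (Z -> R)).
Hypothesis hE : topology_defined_by (tilde gram @` S0).
Hypothesis cE : complete_tvs E.

(** The limit exists at each [x] by completeness of [E], and the estimate for pairs survives when
    one member tends to it. The index type is arbitrary so that [phi] can yield either the operators
    or their adjoints. *)
Lemma uniform_cauchy_limit (I : Type) (F : set_system I) {FF : ProperFilter F}
    (phi : I -> E -> E) :
  (forall p, S0 p -> forall e, 0 < e -> exists2 U, F U & forall a b, U a -> U b ->
     forall x, tilde gram p (phi a x - phi b x) <= e * tilde gram p x) ->
  exists T : E -> E, forall p, S0 p -> forall e, 0 < e ->
    exists2 U, F U & forall a, U a ->
      forall x, tilde gram p (phi a x - T x) <= e * tilde gram p x.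
Proof.
move=> Fc; have ht p : S0 p -> is_seminorm (tilde gram p).
  by move=> Sp; apply: hE.1; exists p.
have lim : forall x : E, exists y : E, phi^~ x @ F --> y.
  move=> x; apply: (@cE (phi^~ x @ F));
  apply/(cauchy_seminormP hE) => _ [p Sp <-] e e0.
  (* The added 1 keeps the divisor positive when [tilde gram p x] is 0. *)
  have x1 : 0 < tilde gram p x + 1 by rewrite ltr_pwDr// (seminorm_ge0 (ht p Sp)).
  have [U FU hU] := Fc p Sp _ (divr_gt0 e0 x1).
  exists (phi^~ x @` U); first by apply: (@filterS _ F _ U) => // a Ua; exists a.
  move=> _ _ [a Ua <-] [b Ub <-]; apply: (le_lt_trans (hU a b Ua Ub x)).
  by rewrite mulrAC ltr_pdivrMr// ltr_pM2l// ltrDl.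
have [T hT] := choice lim; exists T => p Sp e e0.
have [U FU hU] := Fc p Sp e e0; exists U => // a Ua x.
(* The index [b] below depends on [x] and [d], but it leaves no trace in the bound beyond the
   arbitrary [d]. *)
apply/ler_addgt0Pr => d d0.
have /(cvg_seminormP hE)/(_ _ (imageP _ Sp) d d0) Fd := hT x.
have Fd' : F [set b | tilde gram p (phi b x - T x) < d] := Fd.
have [b [Ub /= hb]] := filter_ex (filterI FU Fd').
apply: (le_trans (seminorm_subD (ht p Sp) (phi b x) _ _)).
by rewrite lerD ?hU// ltW.
Qed.

End PointwiseLimit.

(** * Properties inherited by approximated operators *)

Section ApproximatedOperators.
Variables (R : realType) (Z E : lmodType R[i]) (star : Z -> Z) (Zpos : set Z).
Variables (gram : E -> E -> Z) (S0 : set (Z -> R)).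
Hypotheses (hZ : ordered_star_space star Zpos) (hE : ve_space star Zpos gram).
Hypothesis hS0 : forall p, S0 p ->
  [/\ is_seminorm p, increasing Zpos p & is_seminorm (tilde gram p)].
Hypothesis sepZ : forall z, (forall p, S0 p -> p z = 0) -> z = 0.

Lemma tilde_separating x : (forall p, S0 p -> tilde gram p x = 0) -> x = 0.
Proof.
move=> h; apply/(ve_eq0 hE)/sepZ => p Sp; have [hs _ _] := hS0 Sp.
by rewrite -(sqr_tilde _ hs) h// expr0n.
Qed.

(** The approximant may change with the seminorm and the tolerance, so limit arguments can treat one
    seminorm at a time without a filter. *)
Definition approximated_by (A : set (E -> E)) (T : E -> E) : Prop :=
  forall p, S0 p -> forall e, 0 < e -> exists2 V, A V &
    forall x, tilde gram p (V x - T x) <= e * tilde gram p x.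

Lemma approximated_linear T : approximated_by [set V | linear V] T -> linear T.
Proof.
move=> h c x y; apply/eqP; rewrite -subr_eq0; apply/eqP/tilde_separating => p Sp.
have [_ _ ht] := hS0 Sp; apply/eqP; rewrite eq_le seminorm_ge0// andbT.
pose M := tilde gram p (c *: x + y) +
  (complex.Re `|c| * tilde gram p x + tilde gram p y).
apply: (@le0_of_le_eps _ _ M) => e e0; have [V linV hV] := h p Sp e e0.
(* As [V] is linear, the linearity defect of [T] is a combination of the errors [V - T] at three
   points; [M] adds up their weights. *)
have -> : T (c *: x + y) - (c *: T x + T y) =
    - (V (c *: x + y) - T (c *: x + y)) + (c *: (V x - T x) + (V y - T y)).
  by rewrite linV scalerBr opprB [X in _ = _ + X]addrACA -opprD addrA subrK.
apply: (le_trans (seminormD ht _ _)); rewrite (seminormN ht).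
rewrite /M mulrDr lerD ?hV//; apply: (le_trans (seminormD ht _ _)).
rewrite mulrDr lerD ?hV// seminormZ// mulrCA ler_wpM2l ?hV//.
exact: Re_normc_ge0.
Qed.

Lemma approximated_op_bounds p T : S0 p ->
  approximated_by [set V | op_bounds gram p V !=set0] T ->
  op_bounds gram p T !=set0.
Proof.
move=> Sp h; have [_ _ ht] := hS0 Sp.
have [V [C [C0 hC]] hV] := h p Sp 1 ltr01.
(* Here 1 is the approximation error and [C] a bound of the approximant. *)
exists (1 + C); split=> [|x]; first by rewrite addr_ge0.
rewrite -[T x](subrK (V x)) mulrDl.
by apply: (le_trans (seminormD ht _ _)); rewrite (seminorm_sub ht) lerD ?hV ?hC.
Qed.

Lemma approximated_adjoint T T' :
  (forall p, S0 p -> forall e, 0 < e -> exists V V', [/\ is_adjoint gram V V',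
     forall x, tilde gram p (V x - T x) <= e * tilde gram p x &
     forall x, tilde gram p (V' x - T' x) <= e * tilde gram p x]) ->
  is_adjoint gram T T'.
Proof.
move=> h; split=> [|u v].
  apply: approximated_linear => p Sp e e0.
  by have [V [V' [[linV' _] _ hV']]] := h p Sp e e0; exists V'.
apply/eqP; rewrite -subr_eq0; apply/eqP/sepZ => p Sp.
have [hs hi ht] := hS0 Sp; apply/eqP; rewrite eq_le seminorm_ge0// andbT.
pose uv := tilde gram p u * tilde gram p v.
have tge0 x : 0 <= tilde gram p x by exact: seminorm_ge0.
(* The 8 comes from two error terms whose gramians need not be positive, each estimated by the
   Schwarz inequality with constant 4. *)
apply: (@le0_of_le_eps _ _ (8 * uv)) => e e0.
have [V [V' [[_ adj] hV hV']]] := h p Sp e e0.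
have -> : gram (T u) v - gram u (T' v) =
    gram u (V' v - T' v) - gram (V u - T u) v.
  rewrite (gramDr hE) (gramDl hZ hE) (gramNr hE) (gramNl hZ hE) -adj.
  by rewrite opprB [RHS]addrC subrKA.
apply: (le_trans (seminormB hs _ _)).
have b1 := seminorm_gram hZ hE hs ht u (V' v - T' v).
have b2 := seminorm_gram hZ hE hs ht (V u - T u) v.
have c1 : tilde gram p u * tilde gram p (V' v - T' v) <= e * uv.
  by rewrite mulrCA ler_wpM2l.
have c2 : tilde gram p (V u - T u) * tilde gram p v <= e * uv.
  by rewrite mulrA ler_wpM2r.
lra.
Qed.

End ApproximatedOperators.

(** * The locally C*-algebra structure *)

Section LocallyCstar.
Variables (R : realType) (Z : lmodType R[i]) (E : topologicalLmodType R[i]).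
Variables (star : Z -> Z) (Zpos : set Z).
Variables (gram : E -> E -> Z) (S0 : set (Z -> R)).
Hypotheses (hZ : ordered_star_space star Zpos) (hE : ve_space star Zpos gram).
Hypothesis hS0 : forall p, S0 p ->
  [/\ is_seminorm p, increasing Zpos p & is_seminorm (tilde gram p)].
Hypothesis sepZ : forall z, (forall p, S0 p -> p z = 0) -> z = 0.
Hypothesis topE : topology_defined_by (tilde gram @` S0).
Hypothesis cE : complete_tvs E.

Let L := Lbstar_op hZ hE hS0.
Let fn (a : L) : E -> E := Lbstar_fun a.
Let pb p (a : L) : R := pbar gram p (fn a).

Let hfn (a : L) : Lbstar gram S0 (fn a). Proof. exact: Lbstar_funP. Qed.

Let bnd p (a : L) : S0 p -> op_bounds gram p (fn a) !=set0.
Proof. by have [_ _] := hfn a; apply. Qed.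

Lemma pbar_seminorm q : (pb @` S0) q -> is_seminorm q.
Proof.
move=> [p Sp <-]; have [hs hi ht] := hS0 Sp.
split=> [a b|c a]; first exact: (pbarD ht (bnd a Sp) (bnd b Sp)).
exact: (pbarZ ht c (bnd a Sp)).
Qed.

Let A := seminorm_space pbar_seminorm.

(** The default 0 only covers operators without an adjoint; every element of [L] has one. *)
Let adj (T : E -> E) : E -> E := xget (0 : E -> E) (is_adjoint gram T).

Let adjP (a : L) : is_adjoint gram (fn a) (adj (fn a)).
Proof. by have [_ ? _] := hfn a; apply: xgetPex. Qed.

Let astar (a : L) : L :=
  Lbstar_mk hZ hE hS0 (Lbstar_adjoint hZ hE hS0 (hfn a) (adjP a)).

Let amul (a b : L) : L := Lbstar_mk hZ hE hS0 (Lbstar_comp (hfn a) (hfn b)).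

Let astarP (a : L) : is_adjoint gram (fn a) (fn (astar a)).
Proof. exact: adjP. Qed.

Let fn_inj (a b : L) : fn a = fn b -> a = b.
Proof. exact: Lbstar_fun_inj. Qed.

Let fnB (a b : L) x : fn (a - b) x = fn a x - fn b x.
Proof. by []. Qed.

Let A_complete : complete_tvs A.
Proof.
move=> F FF /(cauchy_seminormP (@seminorm_space_topology _ _ _ pbar_seminorm)) Fc.
have Fc1 p : S0 p -> forall e, 0 < e -> exists2 U, F U & forall a b, U a -> U b ->
    op_bounds gram p (fn (a - b)) e.
  move=> Sp e e0; have [U FU hU] := Fc _ (imageP _ Sp) e e0.
  have [_ _ ht] := hS0 Sp.
  exists U => // a b Ua Ub; split=> [|x]; first exact: ltW.
  apply: (le_trans (pbar_le ht (bnd _ Sp) x)).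
  by rewrite ler_wpM2r ?(seminorm_ge0 ht)// ltW// hU.
have [T hT] : exists T : E -> E, forall p, S0 p -> forall e, 0 < e ->
    exists2 U, F U & forall a, U a ->
      forall x, tilde gram p (fn a x - T x) <= e * tilde gram p x.
  apply: (uniform_cauchy_limit topE cE (phi := fn)) => p Sp e e0.
  by have [U FU hU] := Fc1 p Sp e e0; exists U => // a b Ua Ub x; apply: (hU a b Ua Ub).2.
(* The adjoints are Cauchy as well, because every bound of [fn (a - b)] is also a bound of its
   adjoint. *)
have [T' hT'] : exists T' : E -> E, forall p, S0 p -> forall e, 0 < e ->
    exists2 U, F U & forall a, U a ->
      forall x, tilde gram p (fn (astar a) x - T' x) <= e * tilde gram p x.
  apply: (uniform_cauchy_limit topE cE (phi := fn \o astar)) => p Sp e e0.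
  have [U FU hU] := Fc1 p Sp e e0; exists U => // a b Ua Ub x.
  have [hs hi ht] := hS0 Sp.
  have adjab : is_adjoint gram (fn (a - b)) (fn (astar a) - fn (astar b)).
    have [l1 e1] := astarP a; have [l2 e2] := astarP b.
    split=> [c y z|u v].
      by have := Lbstar_funP (astar a - astar b) => -[+ _ _]; apply.
    by rewrite fnB !fctE (gramDl hZ hE) (gramDr hE) (gramNl hZ hE) (gramNr hE) e1 e2.
  exact: (op_bounds_adjoint hZ hE hs hi ht adjab (hU a b Ua Ub)).2.
have LT : Lbstar gram S0 T.
  split=> [||p Sp].
  - apply: (approximated_linear hE hS0 sepZ) => p Sp e e0.
    have [U FU hU] := hT p Sp e e0; have [a Ua] := filter_ex FU.
    by exists (fn a); [by have [] := hfn a|exact: hU].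
  - exists T'; apply: (approximated_adjoint hZ hE hS0 sepZ) => p Sp e e0.
    have [U FU hU] := hT p Sp e e0; have [U' FU' hU'] := hT' p Sp e e0.
    have [a [Ua U'a]] := filter_ex (filterI FU FU').
    exists (fn a), (fn (astar a)); split; [exact: astarP|exact: hU|exact: hU'].
  - apply: (approximated_op_bounds hS0 Sp) => q Sq e e0.
    have [U FU hU] := hT q Sq e e0; have [a Ua] := filter_ex FU.
    by exists (fn a); [exact: bnd|exact: hU].
exists (Lbstar_mk hZ hE hS0 LT).
apply/(cvg_seminormP (@seminorm_space_topology _ _ _ pbar_seminorm)).
(* Halving [e] produces a strict inequality, since a bound [e / 2] only gives [<= e / 2] for the
   infimum. *)
move=> _ [p Sp <-] e e0; have e2 : 0 < e / 2 by rewrite divr_gt0.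
have [U FU hU] := hT p Sp _ e2; apply: filterS FU => a Ua.
apply: (@le_lt_trans _ _ (e / 2)); last by rewrite ltr_pdivrMr// ltr_pMr// ltr1n.
by apply: pbar_le_bound; split=> [|x]; [exact: ltW|exact: hU].
Qed.

Lemma Lbstar_locally_cstar : Lbstar_is_locally_cstar gram S0.
Proof.
have topA := @seminorm_space_topology _ _ _ pbar_seminorm.
(* By uniqueness of adjoints, each law of the involution reduces to exhibiting an adjoint. *)
have adjE (a : L) T : is_adjoint gram (fn a) T -> fn (astar a) = T.
  exact: (adjoint_unique hE (astarP a)).
exists A, amul, astar, fn; split.
  split=> //; apply/seteqP; split=> [_ [a _ <-]|T hT]; first exact: hfn.
  by exists (Lbstar_mk hZ hE hS0 hT).
split.
- split.
  + by move=> a b c; apply: fn_inj.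
  + move=> a c x y; apply: fn_inj; apply: funext => u.
    by have [lin _ _] := hfn a; exact: lin.
  + by move=> a c x y; apply: fn_inj.
  + move=> c a b; apply: fn_inj; apply: adjE.
    exact: (adjoint_linear hZ hE c (astarP a) (astarP b)).
  + move=> a; apply: fn_inj; apply: adjE.
    by apply: (adjoint_sym hE) (astarP a); have [] := hfn a.
  + move=> a b; apply: fn_inj; apply: adjE.
    exact: adjoint_comp (astarP a) (astarP b).
(* An operator on which every [pb p] vanishes sends each [x] to a vector on which every
   [tilde gram p] vanishes. *)
- apply/(hausdorff_seminormP topA) => a h; apply: fn_inj.
  apply: funext => x; apply: (tilde_separating hE hS0 sepZ) => p Sp.
  have [hs hi ht] := hS0 Sp; apply/eqP; rewrite eq_le seminorm_ge0// andbT.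
  apply: (le_trans (pbar_le ht (bnd a Sp) x)).
  by have := h _ (imageP _ Sp); rewrite /pb => ->; rewrite mul0r.
- exact: A_complete.
- exists (pb @` S0); split=> // _ [p Sp <-] a; have [hs hi ht] := hS0 Sp.
  exact: (pbar_cstar hZ hE hs hi ht (astarP a) (bnd a Sp)).
Qed.

End LocallyCstar.

(** * Generating families of seminorms for [Z] and for [E] *)

Section StarSeminorms.
Variables (R : realType) (Z : topologicalLmodType R[i]) (star : Z -> Z).
Variable Zpos : set Z.
Hypothesis hZ : topologically_ordered_star_space star Zpos.

Let hO := toss_ordered hZ.

(** An increasing seminorm [p] of a defining family is dominated by its symmetrization
    [p z + p (star z)], which is continuous because the involution is. It is increasing because
    [0 <= y <= z] makes both [y] and [z] selfadjoint, where it equals twice [p]. *)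
Lemma Sstar_topology : topology_defined_by (Sstar star Zpos).
Proof.
have [S [hS incS]] := toss_topology hZ.
apply: (topology_defined_by_equiv hS) => [q []//|q [hq cq _ _]|p Sp e e0].
  by apply/(continuous_seminormP hS hq).
have hp := hS.1 p Sp; pose sym z := p z + p (star z).
have hsym : is_seminorm sym.
  split=> [y z|a y]; first by rewrite /sym (starD hO) addrACA lerD ?seminormD.
  by rewrite /sym (starZ hO) !(seminormZ hp) norm_conjC mulrDr.
exists [set sym], e; split=> // [_ ->|y /= /(_ _ erefl)]; last first.
  by apply: le_lt_trans; rewrite lerDl seminorm_ge0.
split=> //.
- apply/(continuous_seminormP hS hsym) => d d0.
  have d2 : 0 < d / 2 by rewrite divr_gt0.
  have /(continuous_seminormP hS hp)/(_ _ d2) p2 : continuous p.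
    apply/(continuous_seminormP hS hp) => c c0.
    by have := nbhs_seminorm hS 0 Sp c0; apply: filterS => y /=; rewrite subr0.
  have ps2 : nbhs 0 [set z | p (star z) < d / 2].
    by have := @toss_star_continuous _ _ _ _ hZ 0; rewrite
      /continuous_at (star0 hO) => /(_ _ p2).
  apply: filterS (filterI p2 ps2) => y [/= y1 y2].
  by rewrite /sym [d]splitr ltrD.
- move=> y z yp zyp; have y_sa := oss_selfadjoint hO yp.
  have z_sa : star z = z.
    by rewrite -[z](subrK y) (starD hO) y_sa (oss_selfadjoint hO zyp).
  by rewrite /sym y_sa z_sa lerD// (incS p Sp).
- by move=> z; rewrite /sym (oss_starK hO) addrC.
Qed.

End StarSeminorms.

(** Continuity of [p] in [S] gives a finite [S0]-ball of some radius [d] on which [p < e ^+ 2].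
    Evaluating at [gram y y] and taking square roots turns it into a ball of radius [Num.sqrt d] on
    which [tilde gram p < e]. *)
Lemma tilde_topology (R : realType) (Z E : topologicalLmodType R[i])
    (gram : E -> E -> Z) (S S0 : set (Z -> R)) :
  (forall p, S p -> is_seminorm p /\ continuous p) -> S0 `<=` S ->
  topology_defined_by S0 -> topology_defined_by (tilde gram @` S) ->
  topology_defined_by (tilde gram @` S0).
Proof.
move=> hS S0S top0 topE.
apply: (topology_defined_by_equiv topE) =>
  [_ [p Sp <-]|_ [p Sp <-] e e0|_ [p Sp <-] e e0].
- by apply: topE.1; exists p => //; exact: S0S.
- have := nbhs_seminorm topE 0 (imageP _ (S0S p Sp)) e0.
  by apply: filterS => y /=; rewrite subr0.
have [hp cp] := hS p Sp.
have /(continuous_seminormP top0 hp)/(_ (e ^+ 2)) := cp.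
rewrite exprn_gt0// => /(_ isT)/top0.2 [F [d [finF FS d0 Fd]]].
exists (tilde gram @` F), (Num.sqrt d); split=> //.
- exact: finite_image.
- exact: image_subset.
- by rewrite sqrtr_gt0.
- move=> y /= hy; rewrite /tilde -(ger0_norm (ltW e0)) -(sqrtr_sqr e).
  rewrite ltr_sqrt ?exprn_gt0//; apply: Fd => q Fq /=.
  by have := hy _ (imageP _ Fq); rewrite subr0 /tilde ltr_sqrt.
Qed.

Unset Implicit Arguments.

Theorem corollary2p5 (R : realType) (Z : topologicalLmodType R[i])
    (star : Z -> Z) (Zpos : set Z) (E : topologicalLmodType R[i])
    (gram : E -> E -> Z)
    (hZ : admissible_space star Zpos) (hE : vh_space star Zpos gram) :
  (forall S0 : set (Z -> R), S0 `<=` Sstar star Zpos ->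
     topology_defined_by S0 -> Lbstar_is_locally_cstar gram S0) /\
  Lbstar_is_locally_cstar gram (Sstar star Zpos).
Proof.
have main (S0 : set (Z -> R)) : S0 `<=` Sstar star Zpos ->
    topology_defined_by S0 -> Lbstar_is_locally_cstar gram S0.
  move=> S0S hS0; have hZt := adm_toss hZ; have topE := vh_topology hE.
  apply: (Lbstar_locally_cstar (toss_ordered hZt) (vh_ve hE) _ _ _ (vh_complete hE)).
  - move=> p Sp; have [hp _ ip _] := S0S p Sp; split=> //.
    by apply: topE.1; exists p => //; exact: S0S.
  - by apply/(hausdorff_seminormP hS0)/(toss_hausdorff hZt).
  - by apply: (tilde_topology _ S0S hS0 topE) => p [].
(* [Sstar star Zpos] is itself a generating family, so the second claim is an instance of the
   first. *)
split=> //; apply: main => //; exact: Sstar_topology (adm_toss hZ).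
Qed.
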